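(* Let $G,H,K$ be finite simple graphs. If $G$ and $H$ are homotopic, then $G\times K$ and $H\times K$ are homotopic.
   Context: The unit sphere $S(x)$ of a vertex $x$ is the subgraph induced on the neighbors of $x$. Contractible (inductively): $K_1$ is contractible; a finite simple graph $G$ is contractible if there is a vertex $x$ such that both $S(x)$ and $G\setminus\{x\}$ (remove $x$ and its edges) are contractible. Homotopic: a homotopy step removes from a graph a vertex $x$ whose unit sphere $S(x)$ is contractible, or, in reverse, adds a new vertex joined exactly to the vertices of a contractible induced subgraph. Two finite simple graphs are homotopic if one can be obtained from the other (up to isomorphism) by finitely many homotopy steps. Product: for finite simple graphs $G,H$, the graph $G\times H$ has as vertices all pairs $(x,y)$ with $x$ a nonempty complete subgraph (simplex, identified with its vertex set) of $G$ and $y$ a nonempty complete subgraph of $H$. Two distinct vertices $(x,y)\neq(x',y')$ are adjacent iff ($x\subseteq x'$ and $y\subseteq y'$) or ($x'\subseteq x$ and $y'\subseteq y$). *)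

(* Defs.v *)
From mathcomp Require Import all_boot.

Set Implicit Arguments.
Unset Strict Implicit.
Unset Printing Implicit Defensive.

(* The empty graph is allowed. *)
Record sgraph := SGraph {
  vertex :> finType;
  adj : rel vertex;
  adj_sym : symmetric adj;
  adj_irrefl : irreflexive adj
}.

Definition iso (G H : sgraph) : Prop :=
  exists2 f : G -> H, bijective f & forall x y, adj (f x) (f y) = adj x y.

Section Induced.
Variables (G : sgraph) (A : {set G}).

Definition induced_adj : rel {x : G | x \in A} :=
  fun u v => adj (val u) (val v).

Lemma induced_adj_sym : symmetric induced_adj.
Proof. by move=> u v; rewrite /induced_adj adj_sym. Qed.

Lemma induced_adj_irrefl : irreflexive induced_adj.
Proof. by move=> u; rewrite /induced_adj adj_irrefl. Qed.

Definition induced : sgraph := SGraph induced_adj_sym induced_adj_irrefl.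
End Induced.

Definition sphere (G : sgraph) (x : G) : sgraph := induced [set y | adj x y].

Definition del_vertex (G : sgraph) (x : G) : sgraph := induced [set~ x].

Section AddVertex.
Variables (G : sgraph) (A : {set G}).

(* [None] is the new vertex, joined exactly to the vertices of [A]. *)
Definition add_adj : rel (option G) := fun u v =>
  match u, v with
  | Some x, Some y => adj x y
  | Some x, None | None, Some x => x \in A
  | None, None => false
  end.

Lemma add_adj_sym : symmetric add_adj.
Proof. by case=> [x|] [y|] //=; rewrite adj_sym. Qed.

Lemma add_adj_irrefl : irreflexive add_adj.
Proof. by case=> [x|] //=; rewrite adj_irrefl. Qed.

Definition add_vertex : sgraph := SGraph add_adj_sym add_adj_irrefl.
End AddVertex.

(* A one-vertex graph is a copy of K_1, since [adj] is irreflexive. *)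
Inductive contractible : sgraph -> Prop :=
| contractible_K1 (G : sgraph) : #|G| = 1 -> contractible G
| contractible_step (G : sgraph) (x : G) :
    contractible (sphere x) -> contractible (del_vertex x) -> contractible G.

(* [homotopic G H]: a finite sequence of homotopy steps starting at [G] ends
   at a graph isomorphic to [H]. *)
Inductive homotopic : sgraph -> sgraph -> Prop :=
| homotopic_iso (G H : sgraph) : iso G H -> homotopic G H
| homotopic_remove (G H : sgraph) (x : G) :
    contractible (sphere x) -> homotopic (del_vertex x) H -> homotopic G H
| homotopic_add (G H : sgraph) (A : {set G}) :
    contractible (induced A) -> homotopic (add_vertex A) H -> homotopic G H.

Definition clique (G : sgraph) (A : {set G}) : bool :=
  [forall x in A, forall y in A, (x != y) ==> adj x y].

Definition simplex (G : sgraph) : finType :=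
  {A : {set G} | (A != set0) && clique A}.

Section Product.
Variables G H : sgraph.

Definition prod_adj : rel (simplex G * simplex H) := fun u v =>
  (u != v) &&
  ((val u.1 \subset val v.1) && (val u.2 \subset val v.2)
   || (val v.1 \subset val u.1) && (val v.2 \subset val u.2)).

Lemma prod_adj_sym : symmetric prod_adj.
Proof. by move=> u v; rewrite /prod_adj eq_sym orbC. Qed.

Lemma prod_adj_irrefl : irreflexive prod_adj.
Proof. by move=> u; rewrite /prod_adj eqxx. Qed.

Definition gprod : sgraph := SGraph prod_adj_sym prod_adj_irrefl.
End Product.

(* Main.v *)
(** It suffices to compare [G x K] with [(G - x) x K] when the sphere of [x] is
    contractible. Everything takes place in the comparability graph of pairs of
    sets ordered by inclusion, where the sphere of a pair is the join of its
    lower and its upper link, and a join is contractible as soon as one factor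
    is. First remove the pairs ({x}, t), largest t first: the upper link is then
    {(x u a, b) : a nonempty simplex of S(x), t <= b}, which shrinks onto its
    slice b = t, a copy of the barycentric refinement of S(x). Next remove the
    other pairs (x u a, t) in increasing order: the lower link is then a cone
    with apex (a, t). The same removals with a single t show by induction that
    the barycentric refinement of a contractible graph is contractible. *)

Require Import Defs.
From mathcomp Require Import all_boot.

Set Implicit Arguments.
Unset Strict Implicit.
Unset Printing Implicit Defensive.

(** * Embeddings and their images *)

Definition nbh (G : sgraph) (x : G) : {set G} := [set y | adj x y].

Definition embedding (G H : sgraph) (f : G -> H) : Prop :=
  injective f /\ forall x y, adj (f x) (f y) = adj x y.

Lemma embedding_comp (G H L : sgraph) (g : H -> L) (f : G -> H) :
  embedding g -> embedding f -> embedding (g \o f).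
Proof.
move=> [ginj gadj] [finj fadj]; split; first exact: inj_comp.
by move=> x y; rewrite /= gadj fadj.
Qed.

Lemma embedding_val (G : sgraph) (A : {set G}) :
  embedding (val : induced A -> G).
Proof. by split; first exact: val_inj. Qed.

Lemma imset_val (G : sgraph) (A : {set G}) :
  (val : induced A -> G) @: setT = A.
Proof.
apply/setP=> x; apply/imsetP/idP => [[y _ ->]|xA]; first exact: valP.
by exists (Sub x xA).
Qed.

Lemma imset_sphere (G H : sgraph) (f : G -> H) (x : G) : embedding f ->
  (f \o (val : sphere x -> G)) @: setT = f @: setT :&: nbh (f x).
Proof.
move=> [_ fadj]; rewrite imset_comp imset_val; apply/setP=> y.
rewrite !inE; apply/imsetP/andP => [[z]|[/imsetP[z _ ->]]].
  by rewrite inE => xz ->; rewrite imset_f // fadj.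
by rewrite fadj => xz; exists z; rewrite // inE.
Qed.

Lemma imset_del (G H : sgraph) (f : G -> H) (x : G) : embedding f ->
  (f \o (val : del_vertex x -> G)) @: setT = f @: setT :\ f x.
Proof.
move=> [finj _]; rewrite imset_comp imset_val; apply/setP=> y.
rewrite !inE; apply/imsetP/andP => [[z]|[yx /imsetP[z _ yE]]].
  by rewrite !inE => xz ->; rewrite imset_f // (inj_eq finj).
by exists z; rewrite // !inE; apply: contraNneq yx => <-; rewrite yE.
Qed.

(** Nested induced subgraphs are thus compared through their images in one ambient graph, with no
    manipulation of iterated subtypes. *)
Lemma iso_embedding (G H L : sgraph) (f : G -> L) (g : H -> L) :
  embedding f -> embedding g -> f @: setT = g @: setT -> iso G H.
Proof.
move=> [finj fadj] [ginj gadj] fg.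
(* Equality of the images gives preimages in both directions, taken as data by choice on a decidable
   predicate. *)
have gx x : {y | g y == f x}.
  apply: sigW; have: f x \in g @: setT by rewrite -fg imset_f.
  by case/imsetP=> y _ ->; exists y.
have fy y : {x | f x == g y}.
  apply: sigW; have: g y \in f @: setT by rewrite fg imset_f.
  by case/imsetP=> x _ ->; exists x.
have gE x : g (sval (gx x)) = f x by apply/eqP; case: (gx x).
have fE y : f (sval (fy y)) = g y by apply/eqP; case: (fy y).
exists (fun x => sval (gx x)).
  by exists (fun y => sval (fy y)) => z; [apply: finj|apply: ginj];
     rewrite ?fE ?gE ?fE.
by move=> x y; rewrite -gadj !gE fadj.
Qed.

(** * Contractible vertex sets *)

(** Contractibility relative to a fixed ambient graph: spheres and deletions become intersections
    and differences of sets. *)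
Inductive ctr (G : sgraph) : {set G} -> Prop :=
| ctr1 (x : G) : ctr [set x]
| ctrS (A : {set G}) (x : G) :
    x \in A -> ctr (A :&: nbh x) -> ctr (A :\ x) -> ctr A.

(** Quantifying over every embedding lets the induction pass to the sphere and the deletion by
    composing with [val]. *)
Lemma ctr_of_contractible (L : sgraph) : contractible L ->
  forall (G : sgraph) (f : L -> G), embedding f -> ctr (f @: setT).
Proof.
elim=> {L} [L L1 G f _|L x _ IHs _ IHd G f fE].
  have [x Lx] : exists x : L, [set: L] = [set x].
    by apply/cards1P; rewrite cardsT L1.
  by rewrite Lx imset_set1; apply: ctr1.
apply: (@ctrS _ _ (f x)); first exact: imset_f.
  by rewrite -imset_sphere //; apply/IHs/embedding_comp/embedding_val.
by rewrite -imset_del //; apply/IHd/embedding_comp/embedding_val.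
Qed.

Lemma contractible_of_ctr (G : sgraph) (A : {set G}) : ctr A ->
  forall (L : sgraph) (f : L -> G),
    embedding f -> f @: setT = A -> contractible L.
Proof.
elim=> {A} [x|A x xA _ IHs _ IHd] L f fE fA.
  apply: contractible_K1.
  by rewrite -cardsT -(card_imset _ fE.1) fA cards1.
move: xA; rewrite -fA => /imsetP[y _ xE]; subst x.
apply: (@contractible_step _ y).
  apply: IHs (embedding_comp fE (embedding_val _)) _.
  by rewrite imset_sphere ?fA.
apply: IHd (embedding_comp fE (embedding_val _)) _.
by rewrite imset_del ?fA.
Qed.

(** The conditions bear on [A] only, so that maps such as adding [x] to a set, which are not
    globally injective, qualify. *)
Lemma ctr_imset (G H : sgraph) (f : G -> H) (A : {set G}) :
  {in A &, injective f} -> {in A &, forall x y, adj (f x) (f y) = adj x y} ->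
  ctr A -> ctr (f @: A).
Proof.
move=> finj fadj cA; rewrite -[in f @: A](imset_val A) -imset_comp.
apply: ctr_of_contractible.
  by apply: (contractible_of_ctr cA) (imset_val A); apply: embedding_val.
split=> [u v /= /finj uv|u v /=]; last first.
  by rewrite fadj //; apply: valP.
by apply: val_inj; apply: uv; apply: valP.
Qed.

Lemma setI_nbhK (G : sgraph) (x : G) (A : {set G}) :
  x \notin A :&: nbh x.
Proof. by rewrite !inE adj_irrefl andbF. Qed.

(** Any [y] in [B] can go first: both its sphere and what remains are cones with apex [x] over fewer
    vertices. *)
Lemma ctr_point_join (G : sgraph) (x : G) (B : {set G}) :
  {in B, forall y, adj x y} -> ctr (x |: B).
Proof.
have [n] := ubnP #|B|; elim: n B => // n IH B Bn xB.
have [->|[y yB]] := set_0Vmem B; first by rewrite setU0; apply: ctr1.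
apply: (@ctrS _ _ y); first by rewrite !inE yB orbT.
  have -> : (x |: B) :&: nbh y = x |: B :&: nbh y.
    rewrite setIUl; congr (_ :|: _); apply/setIidPl.
    by rewrite sub1set inE adj_sym xB.
  apply: IH => [|z /setIP[zB _]]; last exact: xB.
  rewrite -ltnS (leq_trans _ Bn) // ltnS; apply: proper_card.
  by apply/properP; split; [apply: subsetIl|exists y; rewrite ?setI_nbhK].
have -> : (x |: B) :\ y = x |: B :\ y.
  rewrite setDUl; congr (_ :|: _); apply/setDidPl.
  rewrite disjoints1 inE; apply: contraTneq (xB _ yB) => ->.
  by rewrite adj_irrefl.
apply: IH => [|z /setD1P[_ zB]]; last exact: xB.
by move: Bn; rewrite (cardsD1 y B) yB.
Qed.

Lemma ctr_cone (G : sgraph) (x : G) (A : {set G}) :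
  x \in A -> {in A, forall y, y != x -> adj x y} -> ctr A.
Proof.
move=> xA Ax; rewrite -(setD1K xA); apply: ctr_point_join => y.
by case/setD1P=> yx yA; apply: Ax.
Qed.

(** Contract [A] while keeping [B]: the sphere of a removed [x] is the join of its sphere in [A]
    with [B], and at the end a cone over [B] is left. *)
Lemma ctr_join (G : sgraph) (A B : {set G}) :
  ctr A -> {in A & B, forall x y, adj x y} -> ctr (A :|: B).
Proof.
elim=> {A} [x xB|A x xA _ IHs _ IHd AB].
  by apply: ctr_point_join => y yB; apply: xB; rewrite ?set11.
apply: (@ctrS _ _ x); first by rewrite inE xA.
  have -> : (A :|: B) :&: nbh x = A :&: nbh x :|: B.
    rewrite setIUl; congr (_ :|: _); apply/setIidPl/subsetP => y yB.
    by rewrite inE AB.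
  by apply: IHs => y z /setIP[yA _]; apply: AB.
have -> : (A :|: B) :\ x = A :\ x :|: B.
  rewrite setDUl; congr (_ :|: _); apply/setDidPl.
  rewrite disjoint_sym disjoints1; apply/negP => /(AB _ _ xA).
  by rewrite adj_irrefl.
by apply: IHd => y z /setD1P[_ yA]; apply: AB.
Qed.

(** * Successive removal of vertices *)

Inductive reduces (G : sgraph) : {set G} -> {set G} -> Prop :=
| reduces_refl (A : {set G}) : reduces A A
| reduces_step (A B : {set G}) (x : G) :
    x \in A -> ctr (A :&: nbh x) -> reduces (A :\ x) B -> reduces A B.

Lemma reduces_trans (G : sgraph) (A B C : {set G}) :
  reduces A B -> reduces B C -> reduces A C.
Proof.
elim=> // {}A {}B x xA cx _ IH BC.
exact: (reduces_step xA cx (IH BC)).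
Qed.

Lemma reduces_ctr (G : sgraph) (A B : {set G}) :
  reduces A B -> ctr B -> ctr A.
Proof. by elim=> // {}A {}B x xA cx _ IH /IH; apply: ctrS. Qed.

(* The vertices of [D] are removed by increasing [h]; when [p] is removed, its
   sphere is the join of [B :&: nbh p] with its remaining neighbors in [D]. *)
Lemma reduces_ordered (G : sgraph) (B D : {set G}) (h : G -> nat) :
  [disjoint B & D] -> {in D, forall p, ctr (B :&: nbh p)} ->
  {in D & D, forall p q, adj p q -> h p <= h q ->
     {in B, forall b, adj p b -> adj b q}} ->
  reduces (B :|: D) B.
Proof.
have [n] := ubnP #|D|; elim: n D => // n IH D Dn BD cB hD.
have [->|[p0 p0D]] := set_0Vmem D; first by rewrite setU0; apply: reduces_refl.
have [p pD hp] : exists2 p, p \in D & {in D, forall q, h p <= h q}.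
  by case: (arg_minnP h p0D) => p; exists p.
have pB : p \notin B.
  by apply/negP => pB; rewrite (disjointFr BD pB) in pD.
apply: (@reduces_step _ _ _ p); first by rewrite inE pD orbT.
  rewrite setIUl; apply: ctr_join => [|b q]; first exact: cB.
  rewrite !inE => /andP[bB pb] /andP[qD pq].
  by apply: (hD p q) => //; apply: hp.
have -> : (B :|: D) :\ p = B :|: D :\ p.
  rewrite setDUl; congr (_ :|: _); apply/setDidPl.
  by rewrite disjoint_sym disjoints1.
apply: IH => [|||q r].
- by move: Dn; rewrite (cardsD1 p D) pD.
- by apply: disjointWr BD; apply: subD1set.
- by move=> q /setD1P[_ qD]; apply: cB.
- by move=> /setD1P[_ qD] /setD1P[_ rD]; apply: hD.
Qed.

(** * Homotopy: isomorphism invariance, transitivity, reversed removals *)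

Lemma iso_sym (G H : sgraph) : iso G H -> iso H G.
Proof.
case=> f [g fK gK] fadj; exists g; first by exists f.
by move=> x y; rewrite -fadj !gK.
Qed.

(** An isomorphism is allowed only at the end of a homotopy; here one at the start is pushed through
    all the steps. *)
Lemma homotopic_isol (G H L : sgraph) :
  iso G H -> homotopic H L -> homotopic G L.
Proof.
move=> GH HL; elim: HL G GH => {H L}.
- move=> H L [g gb gadj] G [f fb fadj]; apply: homotopic_iso.
  exists (g \o f); first exact: bij_comp.
  by move=> x y; rewrite /= gadj fadj.
- move=> H L x cx _ IH G /iso_sym[g gb gadj].
  have gE : embedding g by split; first exact: bij_inj.
  have gsE := embedding_comp gE (embedding_val (nbh x)).
  apply: (@homotopic_remove _ _ (g x)).
    apply: (contractible_of_ctr (ctr_of_contractible cx gsE)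
      (embedding_val _)).
    rewrite imset_val imset_sphere // (_ : g @: setT = setT) ?setTI //.
    apply/setP=> y; rewrite inE; case: gb => k _ gK.
    by rewrite -(gK y) imset_f.
  apply: IH; apply: (iso_embedding (embedding_val _)
    (embedding_comp gE (embedding_val _))).
  rewrite imset_del // imset_val (_ : g @: setT = setT) ?setTD //.
  apply/setP=> y; rewrite inE; case: gb => k _ gK.
  by rewrite -(gK y) imset_f.
- move=> H L A cA _ IH G /iso_sym[g gb gadj].
  have gE : embedding g by split; first exact: bij_inj.
  have cgA := ctr_of_contractible cA (embedding_comp gE (embedding_val A)).
  apply: (@homotopic_add _ _ (g @: A)).
    apply: (contractible_of_ctr cgA (embedding_val _)).
    by rewrite imset_val imset_comp imset_val.
  apply: IH; apply: iso_sym; case: gb => k gK kK.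
  exists (omap g).
    by exists (omap k); case=> //= u; rewrite ?gK ?kK.
  by case=> [u|] [v|] //=; rewrite ?gadj // mem_imset //; apply: gE.1.
Qed.

Lemma homotopic_trans (G H L : sgraph) :
  homotopic G H -> homotopic H L -> homotopic G L.
Proof.
elim=> {G H} [G H|G H x cx _ IH|G H A cA _ IH] HL.
- exact: homotopic_isol.
- by apply: homotopic_remove cx _; apply: IH.
- by apply: homotopic_add cA _; apply: IH.
Qed.

Lemma homotopic_del (G : sgraph) (x : G) :
  contractible (sphere x) -> homotopic (del_vertex x) G.
Proof.
move=> cx; pose A := [set y : del_vertex x | adj x (val y)].
have vA : val @: A = [set: G] :&: nbh x.
  apply/setP=> y; rewrite !inE; apply/imsetP/idP => [[z]|xy].
    by rewrite inE => xz ->.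
  have yx : y \in [set~ x].
    by rewrite !inE; apply: contraTneq xy => ->; rewrite adj_irrefl.
  by exists (Sub y yx); rewrite // inE.
apply: (@homotopic_add _ _ A).
  apply: (contractible_of_ctr (ctr_of_contractible cx (embedding_val _))
    (embedding_comp (embedding_val _) (embedding_val A))).
  by rewrite imset_comp !imset_val vA setTI.
apply: homotopic_iso.
(* The new vertex [None] plays the part of the deleted [x]. *)
have fE : @embedding (add_vertex A) G (oapp val x).
  split=> [[u|] [v|]|[u|] [v|]] //=.
  - by move/val_inj ->.
  - by move=> ux; have := valP u; rewrite !inE => /eqP.
  - by move=> ux; have := valP v; rewrite !inE => /eqP[].
  - by rewrite inE adj_sym.
  - by rewrite inE.
  - by rewrite adj_irrefl.
apply: (iso_embedding fE (g := id)); first by split.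
apply/setP=> y; rewrite imset_id inE; apply/imsetP.
have [->|yx] := eqVneq y x; first by exists None.
have yD : y \in [set~ x] by rewrite !inE.
by exists (Some (Sub y yD)).
Qed.

(** Both directions are carried along because symmetry is not built into [homotopic]; the backward
    one re-adds each removed vertex. *)
Lemma reduces_homotopic (G : sgraph) (A B : {set G}) : reduces A B ->
  forall (L M : sgraph) (f : L -> G) (g : M -> G),
    embedding f -> embedding g -> f @: setT = A -> g @: setT = B ->
    homotopic L M /\ homotopic M L.
Proof.
elim=> {A B} [A|A B x xA cx _ IH] L M f g fE gE fA gB.
  by split; apply: homotopic_iso; [apply: (iso_embedding fE gE)|
    apply: (iso_embedding gE fE)]; rewrite fA gB.
move: xA; rewrite -fA => /imsetP[y _ xE]; subst x.
have cy : contractible (sphere y).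
  apply: (contractible_of_ctr cx (embedding_comp fE (embedding_val _))).
  by rewrite imset_sphere ?fA.
have [yM My] : homotopic (del_vertex y) M /\ homotopic M (del_vertex y).
  apply: (IH _ _ _ _ (embedding_comp fE (embedding_val _)) gE) => //.
  by rewrite imset_del ?fA.
split; first exact: homotopic_remove cy yM.
exact: homotopic_trans My (homotopic_del cy).
Qed.

(** * The product as a comparability graph *)

Section PairGraph.
Variables G K : sgraph.

Definition pair_le (u v : {set G} * {set K}) : bool :=
  (u.1 \subset v.1) && (u.2 \subset v.2).

Definition pair_adj : rel ({set G} * {set K}) := fun u v =>
  (u != v) && (pair_le u v || pair_le v u).

Lemma pair_adj_sym : symmetric pair_adj.
Proof. by move=> u v; rewrite /pair_adj eq_sym orbC. Qed.

Lemma pair_adj_irrefl : irreflexive pair_adj.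
Proof. by move=> u; rewrite /pair_adj eqxx. Qed.

(** All pairs of sets are vertices, so that the products before and after a homotopy step are vertex
    sets of one graph. *)
Definition pair_graph : sgraph := SGraph pair_adj_sym pair_adj_irrefl.

Definition simplex_in (A s : {set G}) : bool :=
  [&& s != set0, s \subset A & clique s].

(** With [Q] all simplices of [K] this is the product with [K]; with [Q] a singleton it is a copy of
    the barycentric refinement of the subgraph on [A]. *)
Definition faces (A : {set G}) (Q : {set {set K}}) : {set pair_graph} :=
  [set u : {set G} * {set K} | simplex_in A u.1 && (u.2 \in Q)].

(** Total size is strictly monotone for [pair_le], so it decides the direction of a comparison and
    can serve as a removal order. *)
Lemma pair_le_card (u v : {set G} * {set K}) :
  pair_le u v || pair_le v u -> #|u.1| + #|u.2| <= #|v.1| + #|v.2| ->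
  pair_le u v.
Proof.
case: u v => [a b] [c d] /orP[//|/andP[/= ca db]] /= h.
have := subset_leq_card ca; have := subset_leq_card db => h1 h2.
rewrite /pair_le /=; have /eqP -> : c == a.
  by rewrite eqEcard ca -(leq_add2r #|b|) (leq_trans h) // leq_add2l.
have /eqP -> : d == b.
  by rewrite eqEcard db -(leq_add2l #|a|) (leq_trans h) // leq_add2r.
by rewrite !subxx.
Qed.

Lemma pair_le_trans : transitive pair_le.
Proof.
move=> v u w /andP[h1 h2] /andP[h3 h4].
by rewrite /pair_le (subset_trans h1) ?(subset_trans h2).
Qed.

Lemma pair_le_anti : antisymmetric pair_le.
Proof.
move=> [a b] [c d] /andP[/andP[/= h1 h2] /andP[/= h3 h4]].
by congr (_, _); apply/eqP; rewrite eqEsubset ?h1 ?h2.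
Qed.

Lemma pair_adj_chain (u v w : {set G} * {set K}) :
  pair_le u v -> pair_le v w -> u != v -> pair_adj u w.
Proof.
move=> uv vw uneqv; rewrite /pair_adj (pair_le_trans uv vw) andbT.
apply: contraNneq uneqv => uw; apply/eqP/pair_le_anti.
by rewrite uv uw vw.
Qed.

Lemma cliqueP (A : {set G}) :
  reflect {in A &, forall x y, x != y -> adj x y} (clique A).
Proof.
apply: (iffP forall_inP) => [h x y xA yA|h x xA].
  by have /forall_inP/(_ y yA)/implyP := h x xA.
by apply/forall_inP => y yA; apply/implyP; apply: h.
Qed.

Lemma clique_sub (A B : {set G}) : A \subset B -> clique B -> clique A.
Proof.
move=> /subsetP AB /cliqueP cB; apply/cliqueP => x y xA yA.
by apply: cB; apply: AB.
Qed.

(* When [D] is removed upwards, the sphere of [p] is the join of what remains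
   above [p] with a cone whose apex is [m p], the largest element of [B]
   below [p]. *)
Lemma reduces_up (B D : {set pair_graph}) (m : pair_graph -> pair_graph) :
  [disjoint B & D] ->
  {in D & B, forall p b, ~~ pair_le p b} ->
  {in D, forall p, [/\ m p \in B, pair_le (m p) p &
     {in B, forall b, pair_le b p -> pair_le b (m p)}]} ->
  reduces (B :|: D) B.
Proof.
move=> BD DB hm.
apply: (@reduces_ordered pair_graph _ _ (fun u => #|u.1| + #|u.2|)) => //.
  move=> p pD; have [mB mp mmax] := hm p pD.
  have mneq : m p != p.
    apply/eqP => mpE; have pB : p \in B by rewrite -mpE.
    by have := DB p p pD pB; rewrite /pair_le !subxx.
  apply: (@ctr_cone _ (m p)).
    by rewrite !inE mB /= /pair_adj mp orbT eq_sym mneq.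
  move=> b; rewrite !inE => /andP[bB] /= /andP[_].
  rewrite (negbTE (DB _ _ pD bB)) /= => bp bneq.
  by rewrite /= /pair_adj (mmax b bB bp) orbT eq_sym bneq.
(* A neighbor [b] of [p] in [B] lies below [p], and [p] lies below [q] by size, so [b] lies below
   [q]. *)
move=> p q pD qD /= /andP[pq /pair_le_card pq'] /pq' {}pq' b bB.
move=> /andP[pb]; rewrite (negbTE (DB _ _ pD bB)) /= => bp.
by apply: (pair_adj_chain bp pq'); rewrite eq_sym.
Qed.

(** Adding [x] is an order isomorphism from the simplices of the sphere of [x] onto the simplices
    that strictly contain [{x}]. *)
Lemma faces_link (A : {set G}) (x : G) (t : {set K}) :
  x \in A -> ctr (faces (A :&: nbh x) [set t]) ->
  ctr [set u : pair_graph |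
        [&& simplex_in A u.1, x \in u.1, u.1 != [set x] & u.2 == t]].
Proof.
move=> xA; set F := faces _ _; set Z := finset _.
pose f (u : pair_graph) : pair_graph := (x |: u.1, u.2).
have xF u : u \in F -> x \notin u.1.
  rewrite inE => /andP[/and3P[_ /subsetP uA _] _].
  by apply/negP => /uA; rewrite !inE adj_irrefl andbF.
have fle : {in F &, forall u v, pair_le (f u) (f v) = pair_le u v}.
  move=> u v uF vF; rewrite /pair_le /=; congr andb.
  apply/idP/idP => [uv|]; last exact: setUS.
  by rewrite -(setU1K (xF u uF)) -(setU1K (xF v vF)) setSD.
have finj : {in F &, injective f}.
  move=> u v uF vF fuv; apply: pair_le_anti.
  by rewrite -(fle u v) // -(fle v u) // fuv /pair_le !subxx.
have -> : Z = f @: F.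
  apply/setP=> -[s u]; rewrite inE; apply/idP/imsetP => /=.
    case/and4P=> /and3P[_ sA cs] xs sx /eqP ->.
    (* Removing [x] leaves a nonempty set since [s] is not [{x}], and one inside the sphere of [x]
       since [s] is a clique. *)
    exists (s :\ x, t); last by rewrite /f /= setD1K.
    rewrite !inE /= eqxx andbT /simplex_in; apply/and3P; split.
    - apply: contraNneq sx => s0.
      by rewrite -(setD1K xs) s0 setU0.
    - apply/subsetP => y; rewrite !inE => /andP[yx ys].
      rewrite (subsetP sA) //=; move/cliqueP: cs; apply=> //.
      by rewrite eq_sym.
    - exact: clique_sub (subD1set _ _) cs.
  case=> v vF [-> ->]; have xv := xF _ vF.
  move: vF; rewrite inE => /andP[/and3P[v0 vA cv]].
  rewrite inE => /eqP ->; rewrite eqxx setU11 andbT /=; apply/andP; split.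
    apply/and3P; split.
    - by apply/set0Pn; exists x; rewrite setU11.
    - by rewrite subUset sub1set xA (subset_trans vA (subsetIl _ _)).
    - have xadj y : y \in v.1 -> adj x y.
        by move/(subsetP vA); rewrite !inE => /andP[].
      apply/cliqueP => y z; rewrite !inE.
      move=> /orP[/eqP ->|yv] /orP[/eqP ->|zv].
      + by rewrite eqxx.
      + by move=> _; apply: xadj.
      + by move=> _; rewrite adj_sym; apply: xadj.
      + by move/cliqueP: cv; apply.
  case/set0Pn: v0 => y yv; apply/eqP => /setP/(_ y).
  rewrite !inE yv orbT => /esym/eqP yx.
  by rewrite -yx yv in xv.
apply: ctr_imset => // u v uF vF /=.
by rewrite /pair_adj !fle // (inj_in_eq finj).
Qed.

(* The pairs [(s, u)] with [u != t] can be removed upwards, each having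
   [(s, t)] as the apex of the part of the slice at [t] below it. *)
Lemma faces_upper_link (A : {set G}) (Q : {set {set K}}) (x : G)
    (t : {set K}) :
  x \in A -> t \in Q -> ctr (faces (A :&: nbh x) [set t]) ->
  ctr [set u : pair_graph | [&& simplex_in A u.1, x \in u.1, u.1 != [set x],
        u.2 \in Q & t \subset u.2]].
Proof.
move=> xA tQ /(faces_link xA); set Z0 := finset _ => cZ0; set Z := finset _.
have -> : Z = Z0 :|: [set u in Z | u.2 != t].
  apply/setP=> -[s u]; rewrite !inE /=.
  by have [->|_] := eqVneq u t; rewrite ?tQ ?subxx !(andbT, andbF, orbF).
apply: reduces_ctr cZ0.
apply: (@reduces_up _ _ (fun u => (u.1, t) : pair_graph)).
- rewrite -setI_eq0; apply/eqP/setP => -[s u]; rewrite !inE /=.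
  by case: (eqVneq u t); rewrite !andbF.
- move=> [s u] [s' u']; rewrite !inE /= => /andP[/and5P[_ _ _ _ tu] ut].
  case/and4P=> _ _ _ /eqP ->; apply: contra ut => /andP[_ /= ut].
  by rewrite eqEsubset ut.
- move=> [s u]; rewrite !inE /= => /andP[/and5P[sA xs sx _ tu] ut].
  split; rewrite ?sA ?xs ?sx ?eqxx /pair_le //= ?subxx //.
  move=> [s' u']; rewrite !inE /= => /and4P[_ _ _ /eqP ->] /andP[-> _].
  exact: subxx.
Qed.

(** Asking for contractibility slice by slice lets this serve both the induction for a single slice
    and the full product. *)
Lemma faces_reduces (A : {set G}) (Q : {set {set K}}) (x : G) :
  x \in A -> {in Q, forall t, ctr (faces (A :&: nbh x) [set t])} ->
  reduces (faces A Q) (faces (A :\ x) Q).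
Proof.
move=> xA cF.
pose D := [set u in faces A Q | u.1 == [set x]].
pose B := [set u in faces A Q | u.1 != [set x]].
apply: (@reduces_trans _ _ B).
  have -> : faces A Q = B :|: D.
    by apply/setP=> u; rewrite !inE; case: eqP; rewrite !(andbT, andbF, orbF).
  (* A singleton is minimal among nonempty sets, so the neighbors in [B] of a pair over [{x}] all
     lie above it. *)
  have Dle p b : p \in D -> b \in B -> pair_adj p b -> pair_le p b.
    case: p b => [s t] [s' t']; rewrite !inE /= => /andP[_ /eqP ->].
    case/andP=> /andP[/and3P[s0 _ _] _] sx /andP[_ /orP[//|/andP[/= s'x _]]].
    by move: s'x; rewrite subset1 (negbTE s0) (negbTE sx).
  (* Removal goes by increasing height, so subtracting from [#|K|] takes the largest second
     components first. *)
  apply: (@reduces_ordered pair_graph _ _ (fun u => #|K| - #|u.2|)).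
  - rewrite -setI_eq0; apply/eqP/setP => u; rewrite !inE.
    by case: eqP; rewrite !(andbF, andbT).
  - move=> [s t] pD; have:= pD; rewrite !inE /= => /andP[/andP[_ tQ] /eqP sE].
    have := faces_upper_link xA tQ (cF t tQ); congr ctr.
    apply/setP=> -[s' t']; apply/idP/idP.
      rewrite !inE /= => /and5P[sA xs sx tQ' tt']; rewrite sA sx tQ' /=.
      rewrite /pair_adj /pair_le /= sE sub1set xs tt' andbT.
      by rewrite xpair_eqE eq_sym (negbTE sx).
    move=> /setIP[bB]; rewrite !inE => pb; have := Dle _ _ pD bB pb.
    move: bB; rewrite !inE /pair_le /= => /andP[/andP[-> ->] ->].
    by rewrite sE sub1set => /andP[-> ->].
  (* Since [p] goes first, [q] lies below [p], hence below every neighbor of [p] in [B]. *)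
  - move=> p q pD qD /= pq hpq b bB pb; rewrite pair_adj_sym.
    apply: (pair_adj_chain _ (Dle _ _ pD bB pb)); last first.
      by rewrite eq_sym; case/andP: pq.
    move: pD qD pq hpq; rewrite !inE => /andP[_ /eqP p1] /andP[_ /eqP q1].
    case/andP=> _ /orP[|//]; rewrite /pair_le p1 q1 subxx /= => pq.
    rewrite leq_sub2lE ?max_card // => qp.
    by have /eqP -> : p.2 == q.2; rewrite // eqEcard pq.
have -> : B = faces (A :\ x) Q :|: [set u in B | x \in u.1].
  apply/setP=> -[s t]; rewrite !inE /= /simplex_in subsetD1.
  have [xs|xs] := boolP (x \in s); rewrite !(andbT, andbF, orbF) //=.
  have -> // : s != [set x]; last by rewrite andbT.
  by apply: contraNneq xs => ->; rewrite set11.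
(* The largest pair avoiding [x] below [u]; its first component is nonempty because the pairs over
   [{x}] are already gone. *)
apply: (@reduces_up _ _ (fun u => (u.1 :\ x, u.2) : pair_graph)).
- rewrite -setI_eq0; apply/eqP/setP => -[s t]; rewrite !inE /= /simplex_in.
  by rewrite subsetD1; case: (x \in s); rewrite !(andbF, andbT).
- move=> [s t] [s' t']; rewrite !inE /= /simplex_in subsetD1.
  case/andP=> _ xs /andP[/and3P[_ /andP[_ xs'] _] _].
  by apply: contra xs' => /andP[/subsetP/(_ x xs)].
- move=> [s t]; rewrite !inE /=.
  case/andP=> /andP[/andP[/and3P[s0 sA cs] tQ] sx xs]; split.
  + rewrite tQ andbT; apply/and3P; split; last 1 first.
    * exact: clique_sub (subD1set _ _) cs.
    * by apply: contraNneq sx => s1; rewrite -(setD1K xs) s1 setU0.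
    * exact: setSD.
  + by rewrite /pair_le /= subD1set subxx.
  + move=> [s' t']; rewrite !inE /= /simplex_in !subsetD1.
    case/andP=> /and3P[_ /andP[_ xs'] _] _ /andP[/= ss tt].
    by rewrite /pair_le /= subsetD1 ss tt xs'.
Qed.

(** Each contraction step of [A] lifts to a reduction of the slice, the induction hypothesis for the
    sphere supplying the required link. *)
Lemma faces_ctr (A : {set G}) (t : {set K}) :
  ctr A -> ctr (faces A [set t]).
Proof.
elim=> {A} [x|A x xA _ IHs _ IHd].
  have -> : faces [set x] [set t] = [set ([set x], t) : pair_graph].
    apply/setP=> -[s u]; rewrite !inE /= xpair_eqE; congr andb.
    apply/and3P/eqP => [[s0 sx _]|->].
      by apply/eqP; move: sx; rewrite subset1 (negbTE s0) orbF.
    split=> //; first by apply/set0Pn; exists x; rewrite set11.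
    by apply/cliqueP => y z; rewrite !inE => /eqP -> /eqP ->; rewrite eqxx.
  exact: ctr1.
apply: reduces_ctr IHd; apply: faces_reduces => // u.
by rewrite inE => /eqP ->.
Qed.

End PairGraph.

(** * Transfer from pairs of sets to the product *)

Definition simplices (K : sgraph) : {set {set K}} :=
  [set t | (t != set0) && clique t].

Definition faces_map (G H K : sgraph) (f : H -> G) (u : gprod H K) :
  pair_graph G K := (f @: val u.1, val u.2).

Lemma faces_map_embedding (G H K : sgraph) (f : H -> G) :
  embedding f -> embedding (@faces_map G H K f).
Proof.
case=> finj _.
have inj : injective (@faces_map G H K f).
  move=> [a b] [c d] [/(imset_inj finj)/val_inj -> /val_inj ->] //.
split=> // u v; rewrite /= /pair_adj /prod_adj (inj_eq inj) /pair_le /=.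
have sub (s s' : {set H}) : (f @: s \subset f @: s') = (s \subset s').
  apply/idP/idP => [/subsetP ss|]; last exact: imsetS.
  by apply/subsetP => x xs; rewrite -(mem_imset _ _ finj) ss ?imset_f.
by rewrite !sub.
Qed.

Lemma imset_faces_map (G H K : sgraph) (f : H -> G) : embedding f ->
  @faces_map G H K f @: setT = faces (f @: setT) (simplices K).
Proof.
case=> finj fadj.
have fclique (s : {set H}) : clique (f @: s) = clique s.
  apply/cliqueP/cliqueP => h x y.
    move=> xs ys xy; rewrite -fadj; apply: h; rewrite ?imset_f //.
    by rewrite (inj_eq finj).
  case/imsetP=> {}x xs -> /imsetP[{}y ys ->]; rewrite (inj_eq finj) fadj.
  exact: h.
apply/setP=> -[s t]; rewrite !inE /=; apply/imsetP/idP.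
  case=> -[a b] _ [-> ->]; rewrite /simplex_in imset_eq0 fclique.
  have /andP[-> ->] := valP a; rewrite (valP b) imsetS ?subsetT //.
case/andP=> /and3P[s0 sf cs] tK.
have sE : s = f @: (f @^-1: s).
  apply/setP=> y; apply/idP/imsetP => [ys|[x + ->]]; last by rewrite inE.
  by have /imsetP[x _ yE] := subsetP sf _ ys; exists x; rewrite // inE -yE.
have sH : (f @^-1: s != set0) && clique (f @^-1: s).
  by rewrite -fclique -(imset_eq0 f (f @^-1: s)) -sE s0.
exists (Sub (f @^-1: s) sH, Sub t tK); first exact: in_setT.
exact: (congr1 (pair^~ t) sE).
Qed.

Lemma embedding_id (G : sgraph) : embedding (@id G).
Proof. by split. Qed.

Lemma gprod_homotopic (G H K : sgraph) (f : H -> G) (x : G) :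
  embedding f -> f @: setT = setT :\ x -> ctr (nbh x) ->
  homotopic (gprod G K) (gprod H K) /\ homotopic (gprod H K) (gprod G K).
Proof.
move=> fE fx cx.
have red : reduces (faces setT (simplices K)) (faces (setT :\ x) (simplices K)).
  apply: faces_reduces => [|t _]; first exact: in_setT.
  by rewrite setTI; apply: faces_ctr.
apply: (reduces_homotopic red).
- exact/faces_map_embedding/embedding_id.
- exact: faces_map_embedding fE.
- by rewrite imset_faces_map ?imset_id //; apply: embedding_id.
- by rewrite imset_faces_map ?fx.
Qed.

Theorem theorem22 (G H K : sgraph) (hGH : homotopic G H) :
  homotopic (gprod G K) (gprod H K).
Proof.
elim: hGH => {G H} [G H [f fb fadj]|G H x cx _ IH|G H A cA _ IH].
- have fE : embedding f by split; first exact: bij_inj.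
  apply/homotopic_iso/(iso_embedding (faces_map_embedding K fE)
    (faces_map_embedding K (embedding_id H))).
  rewrite !imset_faces_map ?imset_id //; last exact: embedding_id.
  congr faces; apply/setP=> y; rewrite inE; case: fb => g _ fK.
  by rewrite -(fK y) imset_f.
- apply: homotopic_trans IH.
  apply: (gprod_homotopic K (embedding_val _) _ _).1.
    by rewrite imset_val setTD.
  have := ctr_of_contractible cx (embedding_val _).
  by rewrite imset_val.
- apply: homotopic_trans IH.
  have sE : @embedding G (add_vertex A) Some by split=> // u v [].
  (* Adding a vertex is the reverse case: [G] is [add_vertex A] with [None] deleted. *)
  apply: (gprod_homotopic K (x := None : add_vertex A) sE _ _).2.
    by apply/setP=> -[y|]; rewrite !inE ?imset_f //; apply/imsetP; case.
  have := ctr_of_contractible cA (embedding_comp sE (embedding_val A)).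
  rewrite imset_comp imset_val; congr ctr; apply/setP=> -[y|].
    by rewrite inE mem_imset //; apply: sE.1.
  by rewrite inE; apply/imsetP; case.
Qed.
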